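(* Let $I$ be a non-trivial admissible ideal in $\mathbb{N}$ and let $x=\{x_k\}_{k\in\mathbb{N}}$ be a sequence of real numbers. Then $\Lambda_x^S(I)\subset\Gamma_x^S(I)$; that is, every $I$-statistical limit point of $x$ is an $I$-statistical cluster point of $x$.
   Context: $\mathbb{N}$ is the set of positive integers. An ideal $I$ in $\mathbb{N}$ is a class of subsets of $\mathbb{N}$ containing $\emptyset$ and closed under finite unions and under taking subsets; it is non-trivial if $\mathbb{N}\notin I$ and admissible if $\{n\}\in I$ for every $n\in\mathbb{N}$. A real sequence $\{a_n\}$ is $I$-convergent to $a$ ($I\text{-}\lim a_n=a$) if $\{n:|a_n-a|\ge\varepsilon\}\in I$ for every $\varepsilon>0$. For $K\subset\mathbb{N}$, the $I$-asymptotic density is $d_I(K)=I\text{-}\lim_{n\to\infty}\frac{|\{j\in K:j\le n\}|}{n}$, when this $I$-limit exists. ''$K$ does not have $I$-asymptotic density zero'' means that it is not the case that $d_I(K)$ exists and equals $0$ (so either $d_I(K)$ is positive or $d_I(K)$ does not exist). For an infinite set $A=\{k_1<k_2<\cdots\}\subset\mathbb{N}$, the subsequence $\{x_{k_j}\}_{j\in\mathbb{N}}$ is called $I$-nonthin if $A$ does not have $I$-asymptotic density zero. A real number $l$ is an $I$-statistical limit point of $x$ if some $I$-nonthin subsequence of $x$ converges (in the ordinary sense) to $l$; $\Lambda_x^S(I)$ is the set of all such $l$. A real number $y$ is an $I$-statistical cluster point of $x$ if for every $\varepsilon>0$ the set $\{k\in\mathbb{N}:|x_k-y|<\varepsilon\}$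 does not have $I$-asymptotic density zero; $\Gamma_x^S(I)$ is the set of all such $y$. *)

(* Defs.v *)
From mathcomp Require Import all_boot all_order all_algebra.
From mathcomp Require Import finmap.
From mathcomp Require Import all_classical all_reals all_analysis.
Import Order.TTheory GRing.Theory Num.Theory.
Import numFieldNormedType.Exports.

Set Implicit Arguments.
Unset Strict Implicit.
Unset Printing Implicit Defensive.

Local Open Scope classical_set_scope.
Local Open Scope ring_scope.

Definition posint : Type := {n : nat | (0 < n)%N}.

Record is_ideal (I : set (set posint)) : Prop := IsIdeal {
  ideal_set0 : I set0 ;
  ideal_setU : forall A B, I A -> I B -> I (A `|` B) ;
  ideal_sub : forall A B, A `<=` B -> I B -> I A }.

Definition nontrivial_ideal (I : set (set posint)) : Prop := ~ I setT.

Definition admissible_ideal (I : set (set posint)) : Prop :=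
  forall n, I [set n].

Section ideal_statistics.
Context (R : realType).
Implicit Types (I : set (set posint)) (K : set posint) (a x : posint -> R).

Definition ideal_cvg I a (l : R) : Prop :=
  forall e : R, 0 < e -> I [set n | e <= `|a n - l|].

(* [fset_set] is the empty fset on an infinite set, but the set here is always
   finite, so this is its actual cardinality. *)
Definition initial_count K (n : posint) : nat :=
  #|` fset_set [set j | K j /\ (val j <= val n)%N]|.

Definition has_ideal_density I K (d : R) : Prop :=
  ideal_cvg I (fun n => (initial_count K n)%:R / (val n)%:R) d.

Definition ideal_nonthin I K : Prop := ~ has_ideal_density I K 0.

(* The strictly increasing [k] enumerates the infinite set [range k], with the
   enumeration starting at [k 0] instead of [k_1]. *)
Definition ideal_stat_limit_points I x : set R :=
  [set l | exists k : nat -> posint,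
    [/\ {homo k : i j / (i < j)%N >-> (val i < val j)%N},
        ideal_nonthin I (range k) &
        x (k j) @[j --> \oo] --> l]].

Definition ideal_stat_cluster_points I x : set R :=
  [set y | forall e : R, 0 < e -> ideal_nonthin I [set k | `|x k - y| < e]].

End ideal_statistics.

(* Main.v *)
(* If [x \o k] converges to [l], then all but finitely many points of [range k]
   satisfy [`|x n - l| < e].  Sets of zero I-density are closed under subsets
   and finite unions, and contain the finite sets because I is admissible; hence
   zero density of [`|x n - l| < e] would force zero density of [range k]. *)
Require Import Defs.
From mathcomp Require Import all_boot all_order all_algebra finmap.
From mathcomp Require Import all_classical all_reals all_analysis.
From mathcomp Require Import lra.
Import Order.TTheory GRing.Theory Num.Theory.

Local Open Scope classical_set_scope.

Lemma finite_posint_le (m : nat) : finite_set [set j : posint | (val j <= m)%N].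
Proof.
apply: (@sub_finite_set _ _ (val @^-1` `I_m.+1)) => //.
by apply: finite_preimage => // i j _ _; exact: val_inj.
Qed.

Lemma finite_initial (K : set posint) (n : posint) :
  finite_set [set j | K j /\ (val j <= val n)%N].
Proof. by apply: sub_finite_set (finite_posint_le (val n)) => j []. Qed.

Lemma initial_countS (A B : set posint) (n : posint) :
  A `<=` B -> (initial_count A n <= initial_count B n)%N.
Proof.
move=> AB; apply/fsubset_leq_card; rewrite -fset_set_sub; try exact: finite_initial.
by move=> j [/AB].
Qed.

Lemma initial_countU (A B : set posint) (n : posint) :
  (initial_count (A `|` B) n <= initial_count A n + initial_count B n)%N.
Proof.
rewrite /initial_count.
have -> : [set j | (A `|` B) j /\ (val j <= val n)%N] =
    [set j | A j /\ (val j <= val n)%N] `|` [set j | B j /\ (val j <= val n)%N].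
  by apply/seteqP; split=> j /=; tauto.
rewrite fset_setU; try exact: finite_initial.
by rewrite cardfsU leq_subr.
Qed.

(** Finiteness of [A] is essential: on an infinite set [fset_set] is empty, so the bound would be
    zero. *)
Lemma initial_count_finite (A : set posint) (n : posint) :
  finite_set A -> (initial_count A n <= #|` fset_set A|)%N.
Proof.
move=> finA; apply/fsubset_leq_card; rewrite -fset_set_sub //.
  by move=> j [].
exact: finite_initial.
Qed.

(** Induction on an enumeration of [A]: admissibility supplies each singleton, and the ideal is
    closed under unions. *)
Lemma ideal_finite (I : set (set posint)) (A : set posint) :
  is_ideal I -> admissible_ideal I -> finite_set A -> I A.
Proof.
move=> [I0 IU Isub] admI /finite_seqP[s ->].
elim: s => [|a s IHs]; first by apply: Isub I0.
apply: Isub (IU _ _ (admI a) IHs) => j /=.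
by rewrite inE => /orP[/eqP|]; [left|right].
Qed.

Section ZeroDensity.
Context (R : realType) (I : set (set posint)) (idealI : is_ideal I).
Local Open Scope ring_scope.

(** The ratio is nonnegative and [val n] positive, so the absolute value and the division both
    disappear. Bounds on counts then apply directly. *)
Lemma has_ideal_density0P (K : set posint) :
  has_ideal_density I K (0 : R) <->
  forall e : R, 0 < e ->
    I [set n | e * (val n)%:R <= (initial_count K n)%:R].
Proof.
suff E (e : R) : [set n | e <= `|(initial_count K n)%:R / (val n)%:R - 0|] =
    [set n | e * (val n)%:R <= (initial_count K n)%:R].
  by split=> H e /H; rewrite E.
apply: eq_set => n; have n0 : 0 < (val n)%:R :> R by rewrite ltr0n (valP n).
by rewrite subr0 ger0_norm ?divr_ge0// ler_pdivlMr.
Qed.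

Lemma has_ideal_density0_sub (A B : set posint) : A `<=` B ->
  has_ideal_density I B (0 : R) -> has_ideal_density I A (0 : R).
Proof.
move=> AB /has_ideal_density0P dB; apply/has_ideal_density0P => e /dB.
apply: (ideal_sub idealI) => n /= /le_trans; apply.
by rewrite ler_nat initial_countS.
Qed.

(** Counts are subadditive: where the count of the union reaches [e * n], that of [A] or of [B]
    reaches [e / 2 * n]. *)
Lemma has_ideal_density0U (A B : set posint) :
  has_ideal_density I A (0 : R) -> has_ideal_density I B (0 : R) ->
  has_ideal_density I (A `|` B) (0 : R).
Proof.
move=> /has_ideal_density0P dA /has_ideal_density0P dB.
apply/has_ideal_density0P => e e0.
have e20 : 0 < e / 2 by lra.
apply: (ideal_sub idealI) (ideal_setU idealI (dA _ e20) (dB _ e20)) => n /= len.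
have : (initial_count (A `|` B) n)%:R <=
    (initial_count A n)%:R + (initial_count B n)%:R :> R.
  by rewrite -natrD ler_nat initial_countU.
move: len; case: (leP (e / 2 * (val n)%:R) (initial_count A n)%:R) => [|ltA].
  by left.
by right => /=; lra.
Qed.

Lemma has_ideal_density0_finite (A : set posint) : admissible_ideal I ->
  finite_set A -> has_ideal_density I A (0 : R).
Proof.
move=> admI finA; apply/has_ideal_density0P => e e0; apply: ideal_finite => //.
(* With [c] the cardinality of [A], [e * n <= c] forces [n <= c / e], so only finitely many [n] are
   exceptional. *)
apply: sub_finite_set
  (finite_posint_le (Num.truncn (#|` fset_set A|%:R / e : R))) => n /= len.
rewrite truncn_ge_nat ?divr_ge0 ?(ltW e0)// ler_pdivlMr// mulrC.
by apply: le_trans len _; rewrite ler_nat initial_count_finite.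
Qed.

End ZeroDensity.

Theorem theorem3p1 (R : realType) (I : set (set posint))
    (idealI : is_ideal I) (nontrivI : nontrivial_ideal I)
    (admI : admissible_ideal I) (x : posint -> R) :
  ideal_stat_limit_points I x `<=` ideal_stat_cluster_points I x.
Proof.
(* Nonthinness is a negation: [dC] assumes zero density near [l], and the goal becomes zero density
   of [range k]. *)
move=> l [k [_ nonthin_k /cvgrPdist_lt xk_l]] e e0 dC; apply: nonthin_k.
have [N _ Nl] := xk_l _ e0.
have dF : has_ideal_density I (k @` `I_N) (0 : R)%R.
  by apply: has_ideal_density0_finite => //; exact/finite_image/finite_II.
apply: has_ideal_density0_sub (has_ideal_density0U _ _ idealI _ _ dC dF) => //.
(* Indices from [N] on give points where [x] is within [e] of [l]; the earlier ones fall in the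
   finite image. *)
move=> _ [j _ <-]; have [Nj|jN] := leqP N j; last by right; exists j.
by left; rewrite /= distrC; exact: Nl.
Qed.
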